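(* Let $f$ be a convex mapping of order $\alpha\in[0,1)$, defined in the unit disk $\mathbb{D}$. Then $$\left|P_f(z)+\frac{\alpha z}{1-\alpha}\right|\ge\frac{1}{1-\alpha}\qquad\text{for all } z\in\mathbb{D}.$$ The inequality is sharp.
   Context: $\mathbb{D}=\{z\in\mathbb{C}:|z|<1\}$. A locally univalent analytic function $f$ in $\mathbb{D}$ (that is, $f'\neq 0$ in $\mathbb{D}$) is a convex mapping of order $\alpha$ if $\operatorname{Re}\{1+z f''(z)/f'(z)\}\ge\alpha$ for all $z\in\mathbb{D}$. The pole function (the pole of the best Möbius approximation of $f$ at $z$) is $P_f(z)=z+2\,f'(z)/f''(z)\in\mathbb{C}\cup\{\infty\}$, with $P_f(z)=\infty$ when $f''(z)=0$; for $c\in\mathbb{C}$, $|\infty+c|=+\infty$. *)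

(* Defs.v *)
From Stdlib Require Import Reals.
From Coquelicot Require Import Coquelicot.

Open Scope R_scope.

Definition unit_disk (z : C) : Prop := Cmod z < 1.

(* Functions on the disk are represented by total maps C -> C whose values
   outside the disk play no role: the radius [r] may be taken as small as one
   likes, and [C_derive f z] only depends on the germ of [f] at [z]. *)
Definition analytic_at (f : C -> C) (z0 : C) : Prop :=
  exists (a : nat -> C) (r : R),
    0 < r /\
    forall z : C, Cmod (z - z0)%C < r -> is_pseries a (z - z0)%C (f z).

Definition analytic_in_disk (f : C -> C) : Prop :=
  forall z0 : C, unit_disk z0 -> analytic_at f z0.

Definition locally_univalent (f : C -> C) : Prop :=
  forall z : C, unit_disk z -> C_derive f z <> RtoC 0.

Definition convex_of_order (alpha : R) (f : C -> C) : Prop :=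
  analytic_in_disk f /\
  locally_univalent f /\
  forall z : C, unit_disk z ->
    Re (RtoC 1 + z * C_derive (C_derive f) z / C_derive f z)%C >= alpha.

(* The Riemann sphere; [None] is the point at infinity. *)
Definition extC : Type := option C.

Definition extC_add (p : extC) (c : C) : extC :=
  match p with
  | Some w => Some (w + c)%C
  | None => None
  end.

Definition extC_mod (p : extC) : Rbar :=
  match p with
  | Some w => Finite (Cmod w)
  | None => p_infty
  end.

Definition pole_function (f : C -> C) (z : C) : extC :=
  if Ceq_dec (C_derive (C_derive f) z) (RtoC 0) then None
  else Some (z + RtoC 2 * C_derive f z / C_derive (C_derive f) z)%C.

(* Main.v *)
Require Import Defs.
From Stdlib Require Import Reals.
From Coquelicot Require Import Coquelicot.
From Stdlib Require Import Lra Lia ClassicalEpsilon.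
From Stdlib Require List.
Open Scope R_scope.

(** Write [c = 1 - alpha]. When [f'' z <> 0],

      [P_f z + alpha z / c = (z f'' + 2 c f') / (c f'')],

    so the inequality says that [|f''| <= |z f'' + 2 c f'|]. Convexity of order [alpha]
    says that [z f'' / f'] has real part at least [- c], that is, it is closer to [0]
    than to [- 2 c]; this gives the weaker inequality [|z f''| <= |z f'' + 2 c f'|].
    Schwarz's lemma removes the factor [z]: the quotient
    [h = f'' / (z f'' + 2 c f')] is analytic and [|z h| <= 1] on the disk, hence
    [|h| <= 1] ([schwarz_division], [convex_second_derivative_bound]).

    The maximum principle behind Schwarz's lemma is proved without Cauchy's integral.
    A point of local maximum of [|h| + eps |z| ^ 2] is excluded by averaging over four
    points around it ([jet_no_interior_max]), which only uses the expansion of [h] to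
    second order with a cubic error. For [f'] and [f''] such expansions come from power
    series: a series can be recentred at every point of its disk
    ([expands_recenter]), this yields termwise differentiation ([expands_derive]), and
    the expansions pass to the quotient [h] ([jet_div]).

    Equality holds at every point of the disk when [f' = (1 - z) ^ (- 2 c)], because then
    [(1 - z) f'' = 2 c f'] and the quotient above is the constant [1 / c]. This [f] is
    built from its Taylor series at [0], whose coefficients satisfy the differential
    equation ([binom_series_ode]); recentring makes it analytic in the whole disk, and a
    Gronwall estimate along rays shows that [f'] does not vanish
    ([gronwall_nonvanishing]). *)

(** * Complex series *)

Definition csum (a : nat -> C) (l : C) : Prop :=
  @is_series C_AbsRing C_NormedModule a l.

(** Convergence in terms of [Cmod]: the filter of neighbourhoods in [C] comes from
    the product uniform structure, whereas every estimate below uses the modulus. *)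
Lemma csum_eps (a : nat -> C) (l : C) :
  csum a l <->
  forall eps, 0 < eps -> exists N, forall n, (N <= n)%nat ->
    Cmod (@sum_n C_AbelianMonoid a n - l)%C < eps.
Proof.
  unfold csum, is_series.
  split.
  - intros H eps He.
    destruct (proj1 (@filterlim_locally_ball_norm C_AbsRing nat C_NormedModule
      eventually _ _ _) H (mkposreal eps He)) as [N HN].
    exists N; intros n Hn; exact (HN n Hn).
  - intros H.
    apply (@filterlim_locally_ball_norm C_AbsRing nat C_NormedModule
      eventually _ _ _).
    intros [eps He]. destruct (H eps He) as [N HN].
    exists N; intros n Hn; exact (HN n Hn).
Qed.

Lemma csum_ext a b l : (forall n, a n = b n) -> csum a l -> csum b l.
Proof. apply is_series_ext. Qed.

Lemma csum_unique a l l' : csum a l -> csum a l' -> l = l'.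
Proof. intros H H'. exact (filterlim_locally_unique _ _ _ H H'). Qed.

Lemma csum_minus a b la lb : csum a la -> csum b lb ->
  csum (fun n => a n - b n)%C (la - lb)%C.
Proof. apply @is_series_minus. Qed.

Lemma csum_scal c a l : csum a l -> csum (fun n => c * a n)%C (c * l)%C.
Proof. apply @is_series_scal. Qed.

Lemma csum_tail a l : csum a l -> csum (fun n => a (S n)) (l - a 0%nat)%C.
Proof.
  intros H. apply @is_series_incr_1.
  replace l with (l - a 0%nat + a 0%nat)%C in H by ring. exact H.
Qed.

Lemma csum_cons a l : csum (fun n => a (S n)) l -> csum a (a 0%nat + l)%C.
Proof.
  intros H. apply @is_series_decr_1.
  replace l with (a 0%nat + l + - a 0%nat)%C in H by ring. exact H.
Qed.

Lemma csum_norm_le a l (b : nat -> R) L :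
  csum a l -> is_series b L -> (forall n, Cmod (a n) <= b n) -> Cmod l <= L.
Proof.
  intros Ha Hb Hab.
  apply (filterlim_le (F := eventually) (fun n => Cmod (@sum_n C_AbelianMonoid a n)) (sum_n b)
           (Cmod l) L).
  - exists 0%nat; intros n _.
    induction n as [|n IH].
    + rewrite !sum_O. apply Hab.
    + rewrite !sum_Sn. eapply Rle_trans; [apply Cmod_triangle|].
      apply Rplus_le_compat; [exact IH|apply Hab].
  - eapply filterlim_comp; [exact Ha|].
    exact (@filterlim_norm C_AbsRing C_NormedModule l).
  - exact Hb.
Qed.

Lemma csum_terms_bounded a l : csum a l ->
  exists M, 0 < M /\ forall n, Cmod (a n) <= M.
Proof.
  intros H. destruct (proj1 (csum_eps a l) H 1 Rlt_0_1) as [N HN].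
  assert (Hf : forall m, exists M, 0 < M /\ forall n, (n <= m)%nat -> Cmod (a n) <= M).
  { induction m as [|m [M [HM IH]]].
    - exists (Cmod (a 0%nat) + 1); split.
      + generalize (Cmod_ge_0 (a 0%nat)); lra.
      + intros n Hn. replace n with 0%nat by lia. lra.
    - exists (M + Cmod (a (S m))); split.
      + generalize (Cmod_ge_0 (a (S m))); lra.
      + intros n Hn. destruct (Nat.eq_dec n (S m)) as [->|Hne]; [lra|].
        specialize (IH n ltac:(lia)).
        generalize (Cmod_ge_0 (a (S m))); lra. }
  destruct (Hf (S N)) as [M [HM HMb]].
  exists (M + 2); split; [lra|]. intros n.
  destruct (Nat.le_gt_cases n (S N)) as [Hn|Hn].
  - specialize (HMb n Hn); lra.
  - destruct n as [|n]; [lia|].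
    assert (H1 := HN n ltac:(lia)). assert (H2 := HN (S n) ltac:(lia)).
    rewrite sum_Sn in H2.
    replace (a (S n)) with
      ((plus (@sum_n C_AbelianMonoid a n) (a (S n)) - l) - (@sum_n C_AbelianMonoid a n - l))%C
      by (change (@plus C_AbelianMonoid) with Cplus; ring).
    eapply Rle_trans; [apply Cmod_triangle|]. rewrite Cmod_opp. lra.
Qed.

(** Domination by a geometric series, the one convergence criterion of this
    development; for power series the domination comes from [expands_coef_bound]. *)
Lemma csum_geometric a M q : 0 <= q < 1 -> (forall n, Cmod (a n) <= M * q ^ n) ->
  exists l, csum a l /\ Cmod l <= M / (1 - q).
Proof.
  intros Hq Ha.
  assert (Hg : is_series (fun n => M * q ^ n) (M / (1 - q))).
  { apply (@is_series_scal R_AbsRing R_NormedModule M). apply is_series_geom. rewrite Rabs_pos_eq; lra. }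
  destruct (@ex_series_le C_AbsRing C_CompleteNormedModule a (fun n => M * q ^ n)) as [l Hl].
  - exact Ha.
  - eexists; exact Hg.
  - exists l; split; [exact Hl|]. exact (csum_norm_le _ _ _ _ Hl Hg Ha).
Qed.

(** * Power series and recentring *)

Definition expands (f : C -> C) (c : C) (rho : R) (a : nat -> C) : Prop :=
  forall w, Cmod w < rho -> csum (fun n => a n * w ^ n)%C (f (c + w)%C).

Lemma expands_ext f c rho a b : (forall n, a n = b n) -> expands f c rho a ->
  expands f c rho b.
Proof.
  intros Hab H w Hw. generalize (H w Hw). apply csum_ext. intros n. now rewrite Hab.
Qed.

Lemma expands_pseries f c rho a : expands f c rho a <->
  forall z, Cmod (z - c)%C < rho -> @is_pseries C_AbsRing C_NormedModule a (z - c)%C (f z).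
Proof.
  split.
  - intros H z Hz. specialize (H _ Hz).
    replace (c + (z - c))%C with z in H by ring.
    revert H. apply csum_ext. intros n. exact (Cmult_comm _ _).
  - intros H w Hw. specialize (H (c + w)%C).
    replace (c + w - c)%C with w in H by ring. specialize (H Hw). revert H.
    apply csum_ext. intros n. exact (Cmult_comm _ _).
Qed.

(** Cauchy-type bound: the series converges at the point [t], so its terms there are bounded. *)
Lemma expands_coef_bound f c rho a t : expands f c rho a -> 0 <= t < rho ->
  exists M, 0 < M /\ forall n, Cmod (a n) * t ^ n <= M.
Proof.
  intros H [Ht Htr].
  assert (Et : Cmod (RtoC t) = t) by (rewrite Cmod_R; apply Rabs_pos_eq; exact Ht).
  destruct (csum_terms_bounded _ _ (H (RtoC t) ltac:(lra))) as [M [HM HMb]].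
  exists M; split; [exact HM|]. intros n. specialize (HMb n).
  rewrite Cmod_mult, Cmod_pow, Et in HMb. exact HMb.
Qed.

(** The coefficient of [w ^ k] in [(u + w) ^ n], that is [binom n k * u ^ (n - k)].
    Pascal's rule as a definition gives [0] for [k > n] and turns every estimate
    on it into an induction without binomial numbers. *)
Fixpoint pascal (u : C) (n k : nat) : C :=
  match n, k with
  | O, O => 1
  | O, S _ => 0
  | S n', O => u * pascal u n' O
  | S n', S k' => u * pascal u n' k + pascal u n' k'
  end%C.

(** The remainder of degree [K] of the binomial expansion of [(u + w) ^ n] in powers of [w]. *)
Fixpoint binom_rem (u w : C) (n K : nat) : C :=
  match K with
  | O => ((u + w) ^ n)%C
  | S K' => (binom_rem u w n K' - pascal u n K' * w ^ K')%C
  end.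

Lemma pascal_0 u n : pascal u n 0 = (u ^ n)%C.
Proof. induction n as [|n IH]; [reflexivity|]. simpl. now rewrite IH. Qed.

Lemma pascal_1 u n : pascal u (S n) 1 = (RtoC (INR (S n)) * u ^ n)%C.
Proof.
  induction n as [|n IH].
  - simpl. ring.
  - change (pascal u (S (S n)) 1) with (u * pascal u (S n) 1 + pascal u (S n) 0)%C.
    rewrite IH, pascal_0, (S_INR (S n)), RtoC_plus. simpl Cpow. ring.
Qed.

(** The left-hand side is one term of the expansion of [(|u| + t) ^ n]. *)
Lemma pascal_bound u t n k : 0 < t ->
  Cmod (pascal u n k) * t ^ k <= (Cmod u + t) ^ n.
Proof.
  intros Ht. assert (Hu := Cmod_ge_0 u).
  revert k; induction n as [|n IH]; intros [|k].
  - simpl. rewrite Cmod_1. lra.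
  - simpl. rewrite Cmod_0. lra.
  - specialize (IH 0%nat). simpl in *. rewrite Cmod_mult.
    generalize (Cmod_ge_0 (pascal u n 0)) (pow_le (Cmod u + t) n ltac:(lra)). nra.
  - change (pascal u (S n) (S k)) with (u * pascal u n (S k) + pascal u n k)%C.
    assert (H1 := IH k). assert (H2 := IH (S k)).
    assert (H3 := Cmod_triangle (u * pascal u n (S k)) (pascal u n k)).
    rewrite Cmod_mult in H3.
    assert (Hk := pow_le t (S k) ltac:(lra)).
    apply (Rmult_le_compat_r _ _ _ Hk) in H3.
    eapply Rle_trans; [exact H3|].
    apply (Rmult_le_compat_l t) in H1; [|lra].
    apply (Rmult_le_compat_l _ _ _ Hu) in H2.
    simpl in *. lra.
Qed.

(** Truncated expansions satisfy the same recursion as the Pascal triangle, which is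
    what makes [binom_rem_bound] an induction on [n]. *)
Lemma binom_rem_pascal u w n K :
  binom_rem u w (S n) (S K) = (u * binom_rem u w n (S K) + w * binom_rem u w n K)%C.
Proof.
  induction K as [|K IH].
  - simpl. ring.
  - change (binom_rem u w (S n) (S (S K))) with
      (binom_rem u w (S n) (S K) - pascal u (S n) (S K) * w ^ S K)%C.
    rewrite IH. simpl. ring.
Qed.

Lemma binom_rem_0_S u w K : binom_rem u w 0 (S K) = RtoC 0.
Proof.
  induction K as [|K IH]; [simpl; ring|].
  change (binom_rem u w 0 (S (S K))) with
    (binom_rem u w 0 (S K) - pascal u 0 (S K) * w ^ S K)%C.
  rewrite IH. simpl. ring.
Qed.

(** The terms of degree [k >= K] gain a factor [(|w| / t) ^ k <= (|w| / t) ^ K] when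
    [t] replaces [|w|], and they then sum to at most [(|u| + t) ^ n]. The bound is
    geometric both in [K] and in [n]. *)
Lemma binom_rem_bound u w t n K : Cmod w < t ->
  Cmod (binom_rem u w n K) <= (Cmod w / t) ^ K * (Cmod u + t) ^ n.
Proof.
  intros Hwt. assert (Hu := Cmod_ge_0 u). assert (Hw := Cmod_ge_0 w).
  assert (Hq : 0 <= Cmod w / t) by (apply Rdiv_le_0_compat; lra).
  revert K; induction n as [|n IH]; intros [|K].
  - simpl. rewrite Cmod_1. lra.
  - rewrite binom_rem_0_S, Cmod_0. apply Rmult_le_pos; apply pow_le; lra.
  - simpl binom_rem. rewrite Cmod_mult, Cmod_pow. simpl pow.
    assert (Ht := Cmod_triangle u w). assert (H0 := Cmod_ge_0 (u + w)).
    rewrite Rmult_1_l. apply Rmult_le_compat; [lra|apply pow_le; lra|lra|].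
    apply pow_incr; lra.
  - rewrite binom_rem_pascal.
    eapply Rle_trans; [apply Cmod_triangle|]. rewrite !Cmod_mult.
    assert (H1 := Rmult_le_compat_l _ _ _ Hu (IH (S K))).
    assert (H2 := Rmult_le_compat_l _ _ _ Hw (IH K)).
    simpl pow in *.
    replace (Cmod w / t * (Cmod w / t) ^ K * ((Cmod u + t) * (Cmod u + t) ^ n))
      with (Cmod u * (Cmod w / t * (Cmod w / t) ^ K * (Cmod u + t) ^ n)
            + Cmod w * ((Cmod w / t) ^ K * (Cmod u + t) ^ n)) by (field; lra).
    lra.
Qed.

(** A power series can be re-expanded at any point [c + u] of its disk. With
    [b k] the sum of [a n * pascal u n k] over [n], the error of the [K]-th partial
    sum of the new series is the sum over [n] of [a n * binom_rem u w n K]; only a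
    finite sum is exchanged with a series, and [binom_rem_bound] makes this error
    tend to [0] like [(|w| / t) ^ K]. The second conclusion identifies [b 1] with the
    termwise derivative at [u]; it is how derivatives are computed later. *)
Lemma expands_recenter f c rho a u : expands f c rho a -> Cmod u < rho ->
  exists b, expands f (c + u)%C (rho - Cmod u) b /\
    csum (fun n => RtoC (INR (S n)) * a (S n) * u ^ n)%C (b 1%nat).
Proof.
  intros Hf Hu. assert (Hu0 := Cmod_ge_0 u).
  assert (Hgeo : forall t, 0 < t < rho - Cmod u -> exists M q, 0 < M /\ 0 <= q < 1 /\
            forall n, Cmod (a n) * (Cmod u + t) ^ n <= M * q ^ n).
  (* a radius strictly between [|u| + t] and [rho], where the coefficient bound applies *)
  { intros t Ht. set (r1 := (Cmod u + t + rho) / 2).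
    destruct (expands_coef_bound f c rho a r1 Hf) as [M [HM HMb]]; [unfold r1; lra|].
    exists M, ((Cmod u + t) / r1).
    assert (Hr1 : Cmod u + t < r1) by (unfold r1; lra).
    split; [exact HM|]. split.
    - split; [apply Rdiv_le_0_compat; lra|]. apply Rlt_div_l; lra.
    - intros n. replace ((Cmod u + t) ^ n) with (r1 ^ n * ((Cmod u + t) / r1) ^ n).
      + rewrite <- Rmult_assoc. apply Rmult_le_compat_r; [|apply HMb].
        apply pow_le, Rdiv_le_0_compat; lra.
      + rewrite <- Rpow_mult_distr. f_equal. field. lra. }
  assert (Hb : forall k, exists l, csum (fun n => a n * pascal u n k)%C l).
  { intros k. set (t := (rho - Cmod u) / 2).
    assert (Ht : 0 < t < rho - Cmod u) by (unfold t; lra).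
    destruct (Hgeo t Ht) as [M [q [HM [Hq HMq]]]].
    destruct (csum_geometric (fun n => a n * pascal u n k)%C (M / t ^ k) q Hq) as [l [Hl _]];
      [|exists l; exact Hl].
    intros n. rewrite Cmod_mult.
    assert (Htk : 0 < t ^ k) by (apply pow_lt; lra).
    apply (Rmult_le_reg_r _ _ _ Htk).
    replace (M / t ^ k * q ^ n * t ^ k) with (M * q ^ n) by (field; lra).
    eapply Rle_trans; [|apply HMq]. rewrite Rmult_assoc.
    apply Rmult_le_compat_l; [apply Cmod_ge_0|]. apply pascal_bound; lra. }
  destruct (choice _ Hb) as [b Hbk]. exists b. split.
  - intros w Hw. assert (Hw0 := Cmod_ge_0 w).
    set (t := (Cmod w + (rho - Cmod u)) / 2).
    assert (Ht : Cmod w < t < rho - Cmod u) by (unfold t; lra).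
    destruct (Hgeo t ltac:(lra)) as [M [q [HM [Hq HMq]]]].
    assert (Hrem : forall K, csum (fun n => a n * binom_rem u w n (S K))%C
              (f (c + u + w) - @sum_n C_AbelianMonoid (fun k => b k * w ^ k)%C K)%C).
    { assert (Hstep : forall k l, csum (fun n => a n * binom_rem u w n k)%C l ->
                csum (fun n => a n * binom_rem u w n (S k))%C (l - b k * w ^ k)%C).
      { intros k l Hl. apply (csum_ext (fun n => a n * binom_rem u w n k
                                          - w ^ k * (a n * pascal u n k))%C).
        - intros n. simpl. ring.
        - rewrite (Cmult_comm (b k)). apply csum_minus; [exact Hl|].
          apply csum_scal, Hbk. }
      induction K as [|K IH].
      - rewrite sum_O. apply Hstep. replace (c + u + w)%C with (c + (u + w))%C by ring.
        apply Hf. eapply Rle_lt_trans; [apply Cmod_triangle|lra].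
      - rewrite sum_Sn. apply Hstep in IH. revert IH.
        change (@plus C_AbelianMonoid) with Cplus.
        match goal with |- csum _ ?x -> csum _ ?y => replace y with x; [easy|ring] end. }
    assert (Hest : forall K, Cmod (@sum_n C_AbelianMonoid (fun k => b k * w ^ k)%C K
               - f (c + u + w))%C <= (Cmod w / t) ^ S K * (M / (1 - q))).
    { intros K.
      destruct (csum_geometric (fun n => a n * binom_rem u w n (S K))%C
                  ((Cmod w / t) ^ S K * M) q Hq) as [l [Hl Hlb]].
      - intros n. rewrite Cmod_mult, Rmult_assoc.
        assert (H1 := binom_rem_bound u w t n (S K) (proj1 Ht)).
        apply (Rmult_le_compat_l _ _ _ (Cmod_ge_0 (a n))) in H1.
        eapply Rle_trans; [exact H1|].
        rewrite <- Rmult_assoc, (Rmult_comm (Cmod (a n))), Rmult_assoc.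
        apply Rmult_le_compat_l; [|apply HMq].
        apply pow_le, Rdiv_le_0_compat; lra.
      - rewrite (csum_unique _ _ _ Hl (Hrem K)) in Hlb.
        rewrite <- Cmod_opp.
        replace (- (@sum_n C_AbelianMonoid (fun k => b k * w ^ k) K - f (c + u + w)))%C
          with (f (c + u + w) - @sum_n C_AbelianMonoid (fun k => b k * w ^ k) K)%C by ring.
        unfold Rdiv in *. lra. }
    apply csum_eps. intros eps Heps.
    assert (HD : 0 < M / (1 - q)) by (apply Rdiv_lt_0_compat; lra).
    assert (Hx : 0 <= Cmod w / t < 1).
    { split; [apply Rdiv_le_0_compat; lra|]. apply Rlt_div_l; lra. }
    destruct (pow_lt_1_zero (Cmod w / t) ltac:(rewrite Rabs_pos_eq; lra)
                (eps / (M / (1 - q))) ltac:(apply Rdiv_lt_0_compat; lra)) as [N HN].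
    exists N. intros n Hn. eapply Rle_lt_trans; [apply Hest|].
    specialize (HN (S n) ltac:(lia)). rewrite Rabs_pos_eq in HN by (apply pow_le; lra).
    apply (Rmult_lt_compat_r _ _ _ HD) in HN.
    unfold Rdiv in HN at 3. rewrite Rmult_assoc, Rinv_l, Rmult_1_r in HN by lra.
    exact HN.
  - replace (b 1%nat) with (b 1%nat - a 0%nat * pascal u 0 1)%C by (simpl; ring).
    apply (csum_ext (fun n => a (S n) * pascal u (S n) 1)%C).
    + intros n. rewrite pascal_1. ring.
    + apply (csum_tail (fun n => a n * pascal u n 1)%C). apply Hbk.
Qed.

(** * Derivatives and Taylor remainders of power series *)

Lemma expands_center f c rho a : expands f c rho a -> 0 < rho -> f c = a 0%nat.
Proof.
  intros H Hr. specialize (H (RtoC 0)). rewrite Cmod_0 in H. specialize (H Hr).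
  replace (c + 0)%C with c in H by ring.
  apply (csum_unique _ _ _ H).
  apply csum_eps. intros eps He. exists 0%nat. intros n _.
  replace (@sum_n C_AbelianMonoid (fun n => a n * 0 ^ n)%C n) with (a 0%nat).
  - replace (a 0%nat - a 0%nat)%C with (RtoC 0) by ring. rewrite Cmod_0. exact He.
  - induction n as [|n IH].
    + rewrite sum_O. simpl. ring.
    + rewrite sum_Sn, <- IH. change (@plus C_AbelianMonoid) with Cplus. simpl. ring.
Qed.

Fixpoint taylor (a : nat -> C) (N : nat) (w : C) : C :=
  match N with
  | O => 0
  | S n => taylor a n w + a n * w ^ n
  end%C.

(** The tail starting at [N] is [w ^ N] times a series dominated by a geometric
    series of ratio [1 / 2] when [|w| <= t / 2]. *)
Lemma expands_remainder f c rho a t N : expands f c rho a -> 0 < t < rho ->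
  exists K, 0 < K /\ forall w, Cmod w <= t / 2 ->
    Cmod (f (c + w) - taylor a N w)%C <= K * Cmod w ^ N.
Proof.
  intros Hf Ht.
  destruct (expands_coef_bound f c rho a t Hf ltac:(lra)) as [M [HM HMb]].
  assert (HtN : 0 < t ^ N) by (apply pow_lt; lra).
  exists (M / t ^ N * 2). split.
  { apply Rmult_lt_0_compat; [apply Rdiv_lt_0_compat; lra|lra]. }
  intros w Hw. assert (Hw0 := Cmod_ge_0 w).
  assert (Htail : forall n, csum (fun k => a (n + k)%nat * w ^ (n + k))%C
     (f (c + w) - taylor a n w)%C).
  { induction n as [|n IH].
    - replace (f (c + w) - taylor a 0 w)%C with (f (c + w)%C) by (simpl; ring).
      apply Hf. lra.
    - apply csum_tail in IH. rewrite Nat.add_0_r in IH. simpl taylor.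
      replace (f (c + w) - (taylor a n w + a n * w ^ n))%C
        with (f (c + w) - taylor a n w - a n * w ^ n)%C by ring.
      revert IH. apply csum_ext. intros k. now rewrite Nat.add_succ_r. }
  destruct (csum_geometric (fun k => a (N + k)%nat * w ^ (N + k))%C
              (M / t ^ N * Cmod w ^ N) (1 / 2)) as [l [Hl Hlb]]; [lra| |].
  - intros k. rewrite Cmod_mult, Cmod_pow.
    assert (H1 := HMb (N + k)%nat).
    assert (Hk : Cmod w ^ k <= t ^ k * (1 / 2) ^ k).
    { rewrite <- Rpow_mult_distr. apply pow_incr. lra. }
    rewrite pow_add in H1. rewrite pow_add.
    replace (M / t ^ N * Cmod w ^ N * (1 / 2) ^ k)
      with (Cmod w ^ N * (1 / 2) ^ k * (M / t ^ N)) by (field; lra).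
    replace (Cmod (a (N + k)%nat) * (Cmod w ^ N * Cmod w ^ k))
      with (Cmod w ^ N * (Cmod (a (N + k)%nat) * Cmod w ^ k)) by ring.
    rewrite Rmult_assoc. apply Rmult_le_compat_l; [apply pow_le; lra|].
    eapply Rle_trans.
    { apply Rmult_le_compat_l; [apply Cmod_ge_0|exact Hk]. }
    replace (Cmod (a (N + k)%nat) * (t ^ k * (1 / 2) ^ k)) with
      ((1 / 2) ^ k * (Cmod (a (N + k)%nat) * t ^ k)) by ring.
    apply Rmult_le_compat_l; [apply pow_le; lra|].
    apply (Rmult_le_reg_r (t ^ N)); [lra|].
    replace (M / t ^ N * t ^ N) with M by (field; lra). lra.
  - rewrite (csum_unique _ _ _ (Htail N) Hl).
    replace (M / t ^ N * Cmod w ^ N / (1 - 1 / 2)) with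
      (M / t ^ N * 2 * Cmod w ^ N) in Hlb by (field; lra). exact Hlb.
Qed.

Lemma C_derive_of_quadratic_error (f : C -> C) c l K t : 0 < t ->
  (forall w, Cmod w <= t -> Cmod (f (c + w) - f c - l * w)%C <= K * Cmod w ^ 2) ->
  C_derive f c = l.
Proof.
  intros Ht HK. apply is_C_lim_unique.
  apply (@filterlim_locally_ball_norm C_AbsRing C C_NormedModule (locally' c) _ _ l).
  intros [eps He].
  assert (HK1 : 0 < Rabs K + 1) by (generalize (Rabs_pos K); lra).
  assert (Hd : 0 < Rmin t (eps / (Rabs K + 1))).
  { apply Rmin_glb_lt; [lra|]. apply Rdiv_lt_0_compat; lra. }
  apply (@locally_le_locally_norm C_AbsRing C_NormedModule).
  exists (mkposreal _ Hd).
  enough (Hmain : forall x : C, Cmod (x - c)%C < Rmin t (eps / (Rabs K + 1)) -> x <> c ->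
            Cmod ((f x - f c) / (x - c) - l)%C < eps) by exact Hmain.
  intros x Hx Hxc.
  assert (Hx1 := Rlt_le_trans _ _ _ Hx (Rmin_l _ _)).
  assert (Hx2 := Rlt_le_trans _ _ _ Hx (Rmin_r _ _)).
  assert (Hne : (x - c)%C <> RtoC 0).
  { intros E. apply Hxc. replace x with (x - c + c)%C by ring. rewrite E. ring. }
  assert (Hpos := proj1 (Cmod_gt_0 _) Hne).
  specialize (HK (x - c)%C ltac:(lra)).
  replace (c + (x - c))%C with x in HK by ring.
  replace ((f x - f c) / (x - c) - l)%C with ((f x - f c - l * (x - c)) / (x - c))%C
    by (field; exact Hne).
  rewrite Cmod_div by exact Hne.
  apply (Rmult_lt_reg_r (Cmod (x - c))); [exact Hpos|].
  unfold Rdiv. rewrite Rmult_assoc, Rinv_l, Rmult_1_r by lra.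
  eapply Rle_lt_trans; [exact HK|].
  apply (Rmult_lt_compat_r (Rabs K + 1)) in Hx2; [|lra].
  unfold Rdiv in Hx2. rewrite Rmult_assoc, Rinv_l, Rmult_1_r in Hx2 by lra.
  generalize (Rle_abs K). nra.
Qed.

Lemma expands_derive_center f c rho a : expands f c rho a -> 0 < rho ->
  C_derive f c = a 1%nat.
Proof.
  intros Hf Hr.
  destruct (expands_remainder f c rho a (rho / 2) 2 Hf ltac:(lra)) as [K [_ HK]].
  apply (C_derive_of_quadratic_error f c _ K (rho / 2 / 2)); [lra|].
  intros w Hw. specialize (HK w Hw). simpl taylor in HK.
  rewrite (expands_center f c rho a Hf Hr).
  replace (f (c + w) - a 0%nat - a 1%nat * w)%C with
    (f (c + w) - (0 + a 0%nat * w ^ 0 + a 1%nat * w ^ 1))%C by (simpl; ring).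
  exact HK.
Qed.

(** Termwise differentiation: at each point of the disk the derivative is the
    coefficient of degree [1] of the series recentred there. *)
Lemma expands_derive f c rho a : expands f c rho a ->
  expands (C_derive f) c rho (fun n => RtoC (INR (S n)) * a (S n))%C.
Proof.
  intros Hf w Hw. destruct (expands_recenter f c rho a w Hf Hw) as [b [Hb Hb1]].
  rewrite (expands_derive_center _ _ _ _ Hb ltac:(lra)). exact Hb1.
Qed.

(** * Second-order jets *)

(** An expansion to second order with a cubic error. It holds for sums of power
    series, passes to quotients by plain algebra, and is all the regularity that the
    maximum principle below requires. *)
Definition quadratic_jet (h : C -> C) (c : C) : Prop :=
  exists h0 h1 h2 K t, 0 < t /\ forall w, Cmod w <= t ->
    Cmod (h (c + w) - (h0 + h1 * w + h2 * w ^ 2))%C <= K * Cmod w ^ 3.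

Lemma expands_jet f c rho a : expands f c rho a -> 0 < rho -> quadratic_jet f c.
Proof.
  intros Hf Hr.
  destruct (expands_remainder f c rho a (rho / 2) 3 Hf ltac:(lra)) as [K [_ HK]].
  exists (a 0%nat), (a 1%nat), (a 2%nat), K, (rho / 2 / 2). split; [lra|].
  intros w Hw. specialize (HK w Hw). simpl taylor in HK.
  replace (a 0%nat + a 1%nat * w + a 2%nat * w ^ 2)%C with
    (0 + a 0%nat * w ^ 0 + a 1%nat * w ^ 1 + a 2%nat * w ^ 2)%C by (simpl; ring).
  exact HK.
Qed.

Lemma jet_center h c h0 h1 h2 K t : 0 < t ->
  (forall w, Cmod w <= t ->
    Cmod (h (c + w) - (h0 + h1 * w + h2 * w ^ 2))%C <= K * Cmod w ^ 3) -> h c = h0.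
Proof.
  intros Ht H. specialize (H (RtoC 0)). rewrite Cmod_0 in H. specialize (H ltac:(lra)).
  replace (c + 0)%C with c in H by ring.
  replace (h c - (h0 + h1 * 0 + h2 * 0 ^ 2))%C with (h c - h0)%C in H by (simpl; ring).
  replace (K * 0 ^ 3) with 0 in H by ring.
  assert (E := Cmod_eq_0 _ (Rle_antisym _ _ H (Cmod_ge_0 _))).
  replace (h c) with (h c - h0 + h0)%C by ring. rewrite E. ring.
Qed.

Lemma jet_lipschitz h c : quadratic_jet h c ->
  exists L t, 0 < L /\ 0 < t /\ forall w, Cmod w <= t ->
    Cmod (h (c + w) - h c)%C <= L * Cmod w.
Proof.
  intros (h0 & h1 & h2 & K & t & Ht & H).
  rewrite (jet_center _ _ _ _ _ _ _ Ht H).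
  exists (Cmod h1 + Cmod h2 + Rabs K + 1), (Rmin t 1).
  assert (H1 := Cmod_ge_0 h1). assert (H2 := Cmod_ge_0 h2). assert (H3 := Rabs_pos K).
  split; [lra|]. split; [apply Rmin_glb_lt; lra|].
  intros w Hw. assert (Hwt := Rle_trans _ _ _ Hw (Rmin_l _ _)).
  assert (Hw1 := Rle_trans _ _ _ Hw (Rmin_r _ _)).
  specialize (H w Hwt). assert (Hw0 := Cmod_ge_0 w).
  replace (h (c + w) - h0)%C with
    ((h (c + w) - (h0 + h1 * w + h2 * w ^ 2)) + (h1 * w + h2 * w ^ 2))%C by ring.
  eapply Rle_trans; [apply Cmod_triangle|].
  assert (H4 := Cmod_triangle (h1 * w) (h2 * w ^ 2)).
  rewrite !Cmod_mult, Cmod_pow in H4.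
  assert (Hw2 : Cmod w ^ 2 <= Cmod w) by nra.
  assert (Hw3 : 0 <= Cmod w ^ 3 <= Cmod w) by (simpl in *; nra).
  assert (K * Cmod w ^ 3 <= Rabs K * Cmod w).
  { generalize (Rle_abs K). nra. }
  nra.
Qed.

(** The jet of the quotient solves the triangular system obtained by multiplying out
    by the denominator. *)
Lemma jet_div u v c : quadratic_jet u c -> quadratic_jet v c -> v c <> RtoC 0 ->
  quadratic_jet (fun z => u z / v z)%C c.
Proof.
  intros Hu Hv Hv0.
  destruct (jet_lipschitz v c Hv) as (L & s & HL & Hs & HvL).
  destruct Hu as (u0 & u1 & u2 & K & t & Ht & HK).
  destruct Hv as (v0 & v1 & v2 & K' & t' & Ht' & HK').
  assert (Ev := jet_center _ _ _ _ _ _ _ Ht' HK'). rewrite Ev in *.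
  set (h0 := (u0 / v0)%C). set (h1 := ((u1 - h0 * v1) / v0)%C).
  set (h2 := ((u2 - h0 * v2 - h1 * v1) / v0)%C).
  assert (Hm := proj1 (Cmod_gt_0 _) Hv0).
  set (A := Cmod h0 + Cmod h1 + Cmod h2).
  set (E := Cmod (h1 * v2 + h2 * v1) + Cmod (h2 * v2)).
  exists h0, h1, h2, ((Rabs K + A * Rabs K' + E) * (2 / Cmod v0)),
    (Rmin (Rmin t t') (Rmin 1 (Rmin s (Cmod v0 / (2 * L))))).
  split.
  { repeat apply Rmin_glb_lt; try lra. apply Rdiv_lt_0_compat; lra. }
  intros w Hw.
  assert (Hwt := Rle_trans _ _ _ Hw (Rmin_l _ _)).
  assert (Hw' := Rle_trans _ _ _ Hw (Rmin_r _ _)).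
  assert (Hwt1 := Rle_trans _ _ _ Hwt (Rmin_l _ _)).
  assert (Hwt2 := Rle_trans _ _ _ Hwt (Rmin_r _ _)).
  assert (Hw1 := Rle_trans _ _ _ Hw' (Rmin_l _ _)).
  assert (Hw'' := Rle_trans _ _ _ Hw' (Rmin_r _ _)).
  assert (Hws := Rle_trans _ _ _ Hw'' (Rmin_l _ _)).
  assert (HwL := Rle_trans _ _ _ Hw'' (Rmin_r _ _)).
  clear Hw Hwt Hw' Hw''.
  specialize (HK w Hwt1). specialize (HK' w Hwt2). specialize (HvL w Hws).
  assert (Hw0 := Cmod_ge_0 w).
  assert (Hlow : Cmod v0 / 2 <= Cmod (v (c + w)%C)).
  { assert (H1 : Cmod v0 <= Cmod (v (c + w)%C) + Cmod (v (c + w) - v0)%C).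
    { replace v0 with (v (c + w) + - (v (c + w) - v0))%C at 1 by ring.
      eapply Rle_trans; [apply Cmod_triangle|]. rewrite Cmod_opp. lra. }
    apply (Rmult_le_compat_l L) in HwL; [|lra].
    replace (L * (Cmod v0 / (2 * L))) with (Cmod v0 / 2) in HwL by (field; lra). lra. }
  assert (Hvw : v (c + w)%C <> RtoC 0) by (apply Cmod_gt_0; lra).
  set (U := (u (c + w) - (u0 + u1 * w + u2 * w ^ 2))%C) in *.
  set (V := (v (c + w) - (v0 + v1 * w + v2 * w ^ 2))%C) in *.
  (* the choice of h0, h1, h2 cancels the terms of degree at most 2 *)
  assert (Eq : (u (c + w) / v (c + w) - (h0 + h1 * w + h2 * w ^ 2) =
    (U - (h0 + h1 * w + h2 * w ^ 2) * V
      - ((h1 * v2 + h2 * v1) + h2 * v2 * w) * w ^ 3) / v (c + w))%C).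
  { unfold U, V, h2, h1, h0. simpl. field. split; assumption. }
  rewrite Eq, Cmod_div by exact Hvw. clear Eq.
  assert (Hnum : Cmod (U - (h0 + h1 * w + h2 * w ^ 2) * V
      - ((h1 * v2 + h2 * v1) + h2 * v2 * w) * w ^ 3)%C
      <= (Rabs K + A * Rabs K' + E) * Cmod w ^ 3).
  { assert (Hw3 : 0 <= Cmod w ^ 3) by (apply pow_le; lra).
    assert (HA : Cmod (h0 + h1 * w + h2 * w ^ 2)%C <= A).
    { unfold A. eapply Rle_trans; [apply Cmod_triangle|].
      assert (H1 := Cmod_triangle h0 (h1 * w)).
      rewrite Cmod_mult in *. rewrite Cmod_pow.
      assert (Cmod w ^ 2 <= 1) by nra.
      generalize (Cmod_ge_0 h1) (Cmod_ge_0 h2). nra. }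
    assert (HE : Cmod ((h1 * v2 + h2 * v1) + h2 * v2 * w)%C <= E).
    { unfold E. eapply Rle_trans; [apply Cmod_triangle|].
      rewrite (Cmod_mult (h2 * v2) w).
      generalize (Cmod_ge_0 (h2 * v2)%C). nra. }
    assert (HV : Cmod V <= Rabs K' * Cmod w ^ 3) by (generalize (Rle_abs K'); nra).
    assert (HU : Cmod U <= Rabs K * Cmod w ^ 3) by (generalize (Rle_abs K); nra).
    unfold Cminus at 1. eapply Rle_trans; [apply Cmod_triangle|].
    rewrite Cmod_opp, Cmod_mult, Cmod_pow.
    unfold Cminus at 1.
    assert (H1 := Cmod_triangle U (- ((h0 + h1 * w + h2 * w ^ 2) * V))).
    rewrite Cmod_opp, Cmod_mult in H1.
    assert (H2 : Cmod (h0 + h1 * w + h2 * w ^ 2)%C * Cmod V <= A * (Rabs K' * Cmod w ^ 3)).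
    { apply Rmult_le_compat; try apply Cmod_ge_0; assumption. }
    apply (Rmult_le_compat_r _ _ _ Hw3) in HE. lra. }
  assert (Hinv : / Cmod (v (c + w)%C) <= 2 / Cmod v0).
  { replace (2 / Cmod v0) with (/ (Cmod v0 / 2)) by (field; lra).
    apply Rinv_le_contravar; lra. }
  unfold Rdiv at 1.
  replace ((Rabs K + A * Rabs K' + E) * (2 / Cmod v0) * Cmod w ^ 3) with
    ((Rabs K + A * Rabs K' + E) * Cmod w ^ 3 * (2 / Cmod v0)) by ring.
  apply Rmult_le_compat; [apply Cmod_ge_0| |exact Hnum|exact Hinv].
  left. apply Rinv_0_lt_compat. lra.
Qed.

Lemma jet_plus u v c : quadratic_jet u c -> quadratic_jet v c ->
  quadratic_jet (fun z => u z + v z)%C c.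
Proof.
  intros (u0 & u1 & u2 & K & t & Ht & HK) (v0 & v1 & v2 & K' & t' & Ht' & HK').
  exists (u0 + v0)%C, (u1 + v1)%C, (u2 + v2)%C, (K + K'), (Rmin t t').
  split; [apply Rmin_glb_lt; lra|]. intros w Hw.
  specialize (HK w (Rle_trans _ _ _ Hw (Rmin_l _ _))).
  specialize (HK' w (Rle_trans _ _ _ Hw (Rmin_r _ _))).
  match goal with |- Cmod ?x <= _ => replace x with
   ((u (c + w) - (u0 + u1 * w + u2 * w ^ 2)) + (v (c + w) - (v0 + v1 * w + v2 * w ^ 2)))%C by ring end.
  eapply Rle_trans; [apply Cmod_triangle|]. lra.
Qed.

Lemma jet_scal k u c : quadratic_jet u c -> quadratic_jet (fun z => k * u z)%C c.
Proof.
  intros (u0 & u1 & u2 & K & t & Ht & HK).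
  exists (k * u0)%C, (k * u1)%C, (k * u2)%C, (Cmod k * K), t. split; [exact Ht|].
  intros w Hw. specialize (HK w Hw).
  match goal with |- Cmod ?x <= _ => replace x with
   (k * (u (c + w) - (u0 + u1 * w + u2 * w ^ 2)))%C by ring end.
  rewrite Cmod_mult, Rmult_assoc. apply Rmult_le_compat_l; [apply Cmod_ge_0|exact HK].
Qed.

Lemma jet_mul_id u c : quadratic_jet u c -> quadratic_jet (fun z => z * u z)%C c.
Proof.
  intros (u0 & u1 & u2 & K & t & Ht & HK).
  exists (c * u0)%C, (c * u1 + u0)%C, (c * u2 + u1)%C, ((Cmod c + t) * Rabs K + Cmod u2), t.
  split; [exact Ht|].
  intros w Hw. specialize (HK w Hw).
  match goal with |- Cmod ?x <= _ => replace x with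
   ((c + w) * (u (c + w) - (u0 + u1 * w + u2 * w ^ 2)) + u2 * w ^ 3)%C by (simpl; ring) end.
  eapply Rle_trans; [apply Cmod_triangle|]. rewrite !Cmod_mult, Cmod_pow.
  assert (Hw3 : 0 <= Cmod w ^ 3) by (apply pow_le, Cmod_ge_0).
  rewrite Rmult_plus_distr_r. apply Rplus_le_compat_r.
  rewrite Rmult_assoc. apply Rmult_le_compat; try apply Cmod_ge_0.
  - eapply Rle_trans; [apply Cmod_triangle|]. lra.
  - generalize (Rle_abs K). nra.
Qed.

(** * Maximum principle and Schwarz's lemma *)

Lemma Cmod_le_Re_Im (z : C) : Cmod z <= Rabs (Re z) + Rabs (Im z).
Proof.
  assert (H1 := Rabs_pos (Re z)). assert (H2 := Rabs_pos (Im z)).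
  apply Rsqr_incr_0_var; [|lra]. rewrite !Rsqr_pow2.
  rewrite Cmod2_alt, <- (pow2_abs (Re z)), <- (pow2_abs (Im z)). nra.
Qed.

Lemma list_argmax {T : Type} (g : T -> R) (l : list T) (x0 : T) : List.In x0 l ->
  exists x, List.In x l /\ forall y, List.In y l -> g y <= g x.
Proof.
  revert x0; induction l as [|a l IH]; intros x0 Hx0; [destruct Hx0|].
  destruct l as [|b l].
  - exists a; split; [now left|]. intros y [<-|[]]. lra.
  - destruct (IH b (or_introl eq_refl)) as [x [Hx Hmax]].
    destruct (Rle_dec (g a) (g x)) as [H|H].
    + exists x; split; [now right|]. intros y [<-|Hy]; [exact H|now apply Hmax].
    + exists a; split; [now left|]. intros y [<-|Hy]; [lra|].
      specialize (Hmax y Hy). lra.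
Qed.

(** If no point were a maximum, each point [t] would have a neighbourhood on which
    [phi] stays below its value at some point [m t] of the disk. Finitely many of these
    neighbourhoods cover the disk; the largest of the corresponding [phi (m t)] would
    then be smaller than one of the others. Compactness is that of a square, so points
    outside the disk receive a neighbourhood that misses it. *)
Lemma usc_attains_max (phi : C -> R) (r : R) : 0 <= r ->
  (forall z, Cmod z <= r -> forall eps, 0 < eps -> exists d, 0 < d /\
     forall z', Cmod z' <= r -> Cmod (z' - z)%C < d -> phi z' < phi z + eps) ->
  exists z, Cmod z <= r /\ forall z', Cmod z' <= r -> phi z' <= phi z.
Proof.
  intros Hr Husc. apply NNPP. intros Hno.
  set (pt := fun t : Compactness.Tn 2 R => ((fst t, fst (snd t)) : C)).
  (* the witness [snd p] is [m t]; the factor [2] absorbs the passage from the maximum norm to [Cmod] *)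
  assert (Hloc : forall t, exists p : posreal * C,
     (Cmod (snd p) <= r) /\
     (forall z', Cmod z' <= r -> Cmod (z' - pt t)%C < 2 * fst p -> phi z' < phi (snd p))).
  { intros t. destruct (Rle_dec (Cmod (pt t)) r) as [Hin|Hout].
    - destruct (classic (exists z', Cmod z' <= r /\ phi (pt t) < phi z')) as [[m [Hm Hlt]]|Hnm].
      + destruct (Husc (pt t) Hin (phi m - phi (pt t)) ltac:(lra)) as [d [Hd Hd']].
        assert (Hd2 : 0 < d / 2) by lra.
        exists (mkposreal _ Hd2, m). split; [exact Hm|]. simpl.
        intros z' Hz' Hzd. specialize (Hd' z' Hz' ltac:(lra)). lra.
      + exfalso. apply Hno. exists (pt t). split; [exact Hin|]. intros z' Hz'.
        apply Rnot_lt_le. intros H. apply Hnm. now exists z'.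
    - assert (Hd2 : 0 < (Cmod (pt t) - r) / 2) by lra.
      exists (mkposreal _ Hd2, RtoC 0). simpl. rewrite Cmod_0. split; [exact Hr|].
      intros z' Hz' Hzd. exfalso.
      assert (H := Cmod_triangle z' (- (z' - pt t))).
      replace (z' + - (z' - pt t))%C with (pt t) in H by ring.
      rewrite Cmod_opp in H. lra. }
  destruct (choice _ Hloc) as [F HF].
  apply (Compactness.compactness_list 2 ((-r), ((-r), tt)) (r, (r, tt)) (fun t => fst (F t))).
  intros [l Hl].
  assert (Hcov : forall z, Cmod z <= r -> exists t, List.In t l /\ Cmod (z - pt t)%C < 2 * fst (F t)).
  { intros z Hz. assert (Hz1 := Rmax_Cmod z).
    assert (Hz2 := Rle_trans _ _ _ (Rmax_l _ _) Hz1).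
    assert (Hz3 := Rle_trans _ _ _ (Rmax_r _ _) Hz1).
    destruct (Hl (fst z, (snd z, tt))) as [t [Ht [_ Hc]]].
    - apply Rabs_le_between in Hz2. apply Rabs_le_between in Hz3.
      simpl. repeat split; lra.
    - exists t; split; [exact Ht|]. destruct t as [t1 [t2 tt2]]. simpl in Hc.
      eapply Rle_lt_trans; [apply Cmod_le_Re_Im|]. simpl.
      destruct Hc as [Hc1 [Hc2 _]]. unfold Rminus in *. lra. }
  destruct (Hcov (RtoC 0)) as [t0 [Ht0 _]]; [rewrite Cmod_0; exact Hr|].
  destruct (list_argmax (fun t => phi (snd (F t))) l t0 Ht0) as [t [Ht Hmax]].
  destruct (Hcov (snd (F t)) (proj1 (HF t))) as [s [Hs Hsd]].
  assert (H1 := proj2 (HF s) _ (proj1 (HF t)) Hsd).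
  specialize (Hmax s Hs). simpl in Hmax. lra.
Qed.

(** Averaging over [c + s], [c - s], [c + i s], [c - i s] kills the terms of degree [1]
    and [2] of [h], so the average of [|h|] is at least [|h c|] up to [O(s ^ 3)], while
    the average of [|.| ^ 2] exceeds [|c| ^ 2] by exactly [s ^ 2]. The perturbation by
    [eps * |.| ^ 2] thus replaces the open mapping theorem or any discussion of the case
    of equality. *)
Lemma jet_no_interior_max (h : C -> C) (c : C) (eps d : R) :
  quadratic_jet h c -> 0 < eps -> 0 < d ->
  exists w, Cmod w <= d /\
    Cmod (h c) + eps * Cmod c ^ 2 < Cmod (h (c + w)%C) + eps * Cmod (c + w)%C ^ 2.
Proof.
  intros (h0 & h1 & h2 & K & t & Ht & HK) He Hd.
  apply NNPP. intros Hno.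
  assert (Hle : forall w, Cmod w <= d ->
    Cmod (h (c + w)%C) + eps * Cmod (c + w)%C ^ 2 <= Cmod (h c) + eps * Cmod c ^ 2).
  { intros w Hw. apply Rnot_lt_le. intros H. apply Hno. now exists w. }
  clear Hno. rewrite (jet_center _ _ _ _ _ _ _ Ht HK) in Hle.
  set (K' := Rabs K + 1).
  assert (HK' : 0 < K') by (unfold K'; generalize (Rabs_pos K); lra).
  set (s := Rmin (Rmin t d) (eps / (2 * K'))).
  assert (Hs : 0 < s).
  { unfold s. repeat apply Rmin_glb_lt; try lra. apply Rdiv_lt_0_compat; lra. }
  assert (Hst : s <= t) by (eapply Rle_trans; [apply Rmin_l|apply Rmin_l]).
  assert (Hsd : s <= d) by (eapply Rle_trans; [apply Rmin_l|apply Rmin_r]).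
  assert (HsK : s * K' <= eps / 2).
  { assert (H : s <= eps / (2 * K')) by apply Rmin_r.
    apply (Rmult_le_compat_r K') in H; [|lra].
    replace (eps / (2 * K') * K') with (eps / 2) in H by (field; lra). exact H. }
  set (w1 := (s, 0) : C). set (w2 := (- s, 0) : C).
  set (w3 := (0, s) : C). set (w4 := (0, - s) : C).
  assert (M1 : Cmod w1 = s).
  { unfold w1. change (s, 0) with (RtoC s). rewrite Cmod_R. apply Rabs_pos_eq; lra. }
  assert (M2 : Cmod w2 = s).
  { replace w2 with (- w1)%C by (unfold w1, w2, Copp; simpl; f_equal; ring).
    now rewrite Cmod_opp. }
  assert (M3 : Cmod w3 = s).
  { replace w3 with (Ci * w1)%C by (unfold w1, w3, Ci, Cmult; simpl; f_equal; ring).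
    rewrite Cmod_mult, Cmod_Ci. lra. }
  assert (M4 : Cmod w4 = s).
  { replace w4 with (- w3)%C by (unfold w3, w4, Copp; simpl; f_equal; ring).
    now rewrite Cmod_opp. }
  (* the sum over the four points kills the terms of degree 1 and 2 of h *)
  assert (Hsum : 4 * Cmod h0 <= Cmod (h (c + w1)%C) + Cmod (h (c + w2)%C)
     + Cmod (h (c + w3)%C) + Cmod (h (c + w4)%C) + 4 * (K' * s ^ 3)).
  { set (e := fun w => (h (c + w) - (h0 + h1 * w + h2 * w ^ 2))%C).
    assert (He' : forall w, Cmod w = s -> Cmod (- e w)%C <= K' * s ^ 3).
    { intros w Hw. rewrite Cmod_opp. unfold e.
      assert (H := HK w ltac:(lra)). rewrite Hw in H.
      eapply Rle_trans; [exact H|]. apply Rmult_le_compat_r; [apply pow_le; lra|].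
      unfold K'. generalize (Rle_abs K). lra. }
    replace (4 * Cmod h0) with (Cmod (RtoC 4 * h0)%C)
      by (rewrite Cmod_mult, Cmod_R, Rabs_pos_eq; lra).
    assert (Eq : (RtoC 4 * h0 = (((((((h (c + w1) + h (c + w2)) + h (c + w3)) + h (c + w4))
      + - e w1) + - e w2) + - e w3) + - e w4))%C).
    { transitivity (RtoC 4 * h0 + h1 * (w1 + w2 + w3 + w4)
         + h2 * (w1 ^ 2 + w2 ^ 2 + w3 ^ 2 + w4 ^ 2))%C.
      - replace (w1 + w2 + w3 + w4)%C with (RtoC 0)
          by (unfold w1, w2, w3, w4, Cplus, RtoC; simpl; f_equal; ring).
        replace (w1 ^ 2 + w2 ^ 2 + w3 ^ 2 + w4 ^ 2)%C with (RtoC 0)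
          by (unfold w1, w2, w3, w4, Cplus, Cmult, RtoC; simpl; f_equal; ring).
        ring.
      - unfold e. ring. }
    rewrite Eq.
    assert (T := Cmod_triangle).
    repeat (eapply Rle_trans; [apply T|]).
    generalize (He' w1 M1) (He' w2 M2) (He' w3 M3) (He' w4 M4).
    generalize (T (((((h (c + w1) + h (c + w2)) + h (c + w3)) + h (c + w4))
      + - e w1) + - e w2)%C (- e w3)%C)
     (T ((((h (c + w1) + h (c + w2)) + h (c + w3)) + h (c + w4))
      + - e w1)%C (- e w2)%C)
     (T (((h (c + w1) + h (c + w2)) + h (c + w3)) + h (c + w4))%C (- e w1)%C)
     (T ((h (c + w1) + h (c + w2)) + h (c + w3))%C (h (c + w4)%C))
     (T (h (c + w1) + h (c + w2))%C (h (c + w3)%C))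
     (T (h (c + w1)%C) (h (c + w2)%C)).
    lra. }
  assert (Hsq : Cmod (c + w1)%C ^ 2 + Cmod (c + w2)%C ^ 2 + Cmod (c + w3)%C ^ 2
     + Cmod (c + w4)%C ^ 2 = 4 * Cmod c ^ 2 + 4 * s ^ 2).
  { rewrite !Cmod2_alt. unfold w1, w2, w3, w4, Re, Im. simpl. ring. }
  assert (L1 := Hle w1 ltac:(lra)). assert (L2 := Hle w2 ltac:(lra)).
  assert (L3 := Hle w3 ltac:(lra)). assert (L4 := Hle w4 ltac:(lra)).
  assert (Hs2 : 0 < s ^ 2) by (apply pow_lt; lra).
  assert (H3 : K' * s ^ 3 <= eps / 2 * s ^ 2).
  { replace (K' * s ^ 3) with (s * K' * s ^ 2) by ring.
    apply Rmult_le_compat_r; lra. }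
  assert (0 < eps * s ^ 2) by (apply Rmult_lt_0_compat; lra).
  assert (eps * (Cmod (c + w1)%C ^ 2 + Cmod (c + w2)%C ^ 2 + Cmod (c + w3)%C ^ 2
     + Cmod (c + w4)%C ^ 2) = eps * (4 * Cmod c ^ 2 + 4 * s ^ 2)) by now rewrite Hsq.
  lra.
Qed.

(** Schwarz's lemma for [z * h z], in the form that does not need to divide by [z].
    The maximum over [|z| <= r] of [|h z| + eps * |z| ^ 2] lies on the circle [|z| = r],
    where [|h| <= 1 / r]; then [r] tends to [1] and [eps] to [0]. *)
Lemma schwarz_division (h : C -> C) :
  (forall z, Cmod z < 1 -> quadratic_jet h z) ->
  (forall z, Cmod z < 1 -> Cmod (z * h z)%C <= 1) ->
  forall z, Cmod z < 1 -> Cmod (h z) <= 1.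
Proof.
  intros Hjet Hb z Hz. assert (Hz0 := Cmod_ge_0 z).
  assert (Hr : forall r eps, Cmod z <= r < 1 -> 0 < r -> 0 < eps -> Cmod (h z) <= / r + eps).
  { intros r eps Hr Hr0 He.
    set (phi := fun x => Cmod (h x) + eps * Cmod x ^ 2).
    assert (Hbd : forall x, 0 <= eps * Cmod x ^ 2).
    { intros x. apply Rmult_le_pos; [lra|]. apply pow_le, Cmod_ge_0. }
    destruct (usc_attains_max phi r ltac:(lra)) as [m [Hm Hmax]].
    - intros x Hx e' He'.
      destruct (jet_lipschitz h x (Hjet x ltac:(lra))) as (L & t & HL & Ht & HLip).
      (* [D] is a Lipschitz constant of [phi] at [x]: [|.| ^ 2] is [2]-Lipschitz on the unit disk *)
      set (D := L + 2 * eps).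
      exists (Rmin t (e' / D)).
      split.
      { apply Rmin_glb_lt; [lra|]. apply Rdiv_lt_0_compat; [lra|unfold D; lra]. }
      intros x' Hx' Hd.
      assert (Hd1 := Rlt_le_trans _ _ _ Hd (Rmin_l _ _)).
      assert (Hd2 := Rlt_le_trans _ _ _ Hd (Rmin_r _ _)).
      specialize (HLip (x' - x)%C ltac:(lra)).
      replace (x + (x' - x))%C with x' in HLip by ring.
      assert (H1 := Cmod_triangle (h x) (h x' - h x)).
      replace (h x + (h x' - h x))%C with (h x') in H1 by ring.
      assert (H2 := Cmod_triangle x (x' - x)).
      replace (x + (x' - x))%C with x' in H2 by ring.
      assert (Hx0 := Cmod_ge_0 x). assert (Hx0' := Cmod_ge_0 x').
      assert (Hw0 := Cmod_ge_0 (x' - x)).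
      apply (Rmult_lt_compat_r D) in Hd2; [|unfold D; lra].
      replace (e' / D * D) with e' in Hd2 by (field; unfold D; lra).
      unfold phi. unfold D in Hd2.
      assert (Cmod x' ^ 2 <= Cmod x ^ 2 + 2 * Cmod (x' - x)%C) by nra.
      nra.
    - assert (Hedge : Cmod m = r).
      { apply Rle_antisym; [exact Hm|]. apply Rnot_lt_le. intros Hlt.
        destruct (jet_no_interior_max h m eps (r - Cmod m) (Hjet m ltac:(lra)) He ltac:(lra))
          as [w [Hw Hgt]].
        specialize (Hmax (m + w)%C). unfold phi in Hmax.
        assert (H := Cmod_triangle m w). specialize (Hmax ltac:(lra)). lra. }
      specialize (Hmax z ltac:(lra)). unfold phi in Hmax.
      specialize (Hb m ltac:(lra)). rewrite Cmod_mult, Hedge in Hb.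
      assert (Hh : Cmod (h m) <= / r).
      { apply (Rmult_le_reg_l r); [lra|]. rewrite Rinv_r; lra. }
      specialize (Hbd z). rewrite Hedge in Hmax.
      assert (r ^ 2 <= 1) by nra. nra. }
  apply le_epsilon. intros e He.
  set (r := Rmax (Cmod z) (/ (1 + e / 2))).
  assert (Hi : 0 < / (1 + e / 2) < 1).
  { split; [apply Rinv_0_lt_compat; lra|]. apply Rlt_le_trans with (/ 1); [|rewrite Rinv_1; lra].
    apply Rinv_lt_contravar; lra. }
  assert (Hr1 : / (1 + e / 2) <= r) by apply Rmax_r.
  assert (Hr2 : Cmod z <= r) by apply Rmax_l.
  assert (Hr3 : r < 1) by (apply Rmax_lub_lt; lra).
  specialize (Hr r (e / 2) ltac:(lra) ltac:(lra) ltac:(lra)).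
  assert (/ r <= 1 + e / 2).
  { rewrite <- (Rinv_inv (1 + e / 2)). apply Rinv_le_contravar; lra. }
  lra.
Qed.

(** * The bound on the pole function *)

Lemma expands_of_analytic f z : analytic_at f z -> exists rho a, 0 < rho /\ expands f z rho a.
Proof.
  intros (a & r & Hr & H). exists r, a. split; [exact Hr|]. now apply expands_pseries.
Qed.

(** The half-plane [Re q >= - c] consists of points closer to [0] than to [- 2 c]. *)
Lemma half_plane_Cmod (q : C) (c : R) : 0 < c -> - c <= Re q ->
  Cmod q <= Cmod (q + RtoC (2 * c))%C.
Proof.
  intros Hc Hq. apply Rsqr_incr_0_var; [|apply Cmod_ge_0].
  rewrite !Rsqr_pow2, !Cmod2_alt.
  replace (Re (q + RtoC (2 * c))%C) with (Re q + 2 * c) by (unfold Re; simpl; ring).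
  replace (Im (q + RtoC (2 * c))%C) with (Im q) by (unfold Im; simpl; ring).
  nra.
Qed.

(** The inequality of the theorem cleared of denominators. With [q = z f'' / f'] and
    [c = 1 - alpha], convexity of order [alpha] says [Re q >= - c], so
    [|q| <= |q + 2 c|]; hence [h = f'' / (z f'' + 2 c f')] satisfies [|z h| <= 1], and
    [schwarz_division] improves this to [|h| <= 1]. *)
Lemma convex_second_derivative_bound (alpha : R) (f : C -> C) :
  alpha < 1 -> convex_of_order alpha f -> forall z, unit_disk z ->
  Cmod (C_derive (C_derive f) z) <=
  Cmod (z * C_derive (C_derive f) z + RtoC (2 * (1 - alpha)) * C_derive f z)%C.
Proof.
  intros Ha (Hana & Hloc & Hre).
  set (c := 1 - alpha). assert (Hc : 0 < c) by (unfold c; lra).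
  set (f1 := C_derive f) in *. set (f2 := C_derive f1) in *.
  set (v := fun z => (z * f2 z + RtoC (2 * c) * f1 z)%C).
  set (q := fun z => (z * f2 z / f1 z)%C).
  assert (Hv : forall z, unit_disk z -> v z = (f1 z * (q z + RtoC (2 * c)))%C).
  { intros z Hz. unfold v, q. field. now apply Hloc. }
  assert (Hq : forall z, unit_disk z -> - c <= Re (q z)).
  { intros z Hz. specialize (Hre z Hz). unfold q, c.
    replace (Re (1 + z * f2 z / f1 z)%C) with (1 + Re (z * f2 z / f1 z)%C) in Hre
      by reflexivity. lra. }
  assert (Hv0 : forall z, unit_disk z -> v z <> RtoC 0).
  { intros z Hz. rewrite Hv by exact Hz. apply Cmult_neq_0; [now apply Hloc|].
    intros E. apply (f_equal Re) in E. specialize (Hq z Hz).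
    change (Re (q z) + 2 * c = 0) in E. lra. }
  intros z Hz.
  change (Cmod (f2 z) <= Cmod (v z)).
  assert (Hh : Cmod (f2 z / v z)%C <= 1).
  { apply (schwarz_division (fun z => f2 z / v z)%C); [| |exact Hz].
    - intros x Hx. destruct (expands_of_analytic f x (Hana x Hx)) as (rho & a & Hr & Hf).
      assert (J1 := expands_jet _ _ _ _ (expands_derive _ _ _ _ Hf) Hr).
      assert (J2 := expands_jet _ _ _ _ (expands_derive _ _ _ _ (expands_derive _ _ _ _ Hf)) Hr).
      apply jet_div; [exact J2| |now apply Hv0].
      apply jet_plus; [now apply jet_mul_id|now apply jet_scal].
    - intros x Hx. assert (Hvx := proj1 (Cmod_gt_0 _) (Hv0 x Hx)).
      replace (x * (f2 x / v x))%C with (f1 x * q x / v x)%C.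
      + rewrite Cmod_div by (now apply Hv0). apply Rle_div_l; [exact Hvx|].
        rewrite (Hv x Hx), !Cmod_mult, Rmult_1_l.
        apply Rmult_le_compat_l; [apply Cmod_ge_0|]. apply half_plane_Cmod; [exact Hc|].
        now apply Hq.
      + unfold q. field. split; [now apply Hv0|now apply Hloc]. }
  assert (Hvz := proj1 (Cmod_gt_0 _) (Hv0 z Hz)).
  rewrite Cmod_div in Hh by (now apply Hv0). apply Rle_div_l in Hh; lra.
Qed.

Lemma shifted_pole (alpha : R) (f : C -> C) (z : C) : alpha < 1 ->
  C_derive (C_derive f) z <> RtoC 0 ->
  extC_add (pole_function f z) (RtoC alpha * z / RtoC (1 - alpha))%C =
  Some ((z * C_derive (C_derive f) z + RtoC (2 * (1 - alpha)) * C_derive f z)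
        / (RtoC (1 - alpha) * C_derive (C_derive f) z))%C.
Proof.
  intros Ha H. unfold pole_function.
  destruct (Ceq_dec (C_derive (C_derive f) z) (RtoC 0)) as [E|_]; [contradiction|].
  simpl. f_equal. rewrite RtoC_mult, RtoC_minus. field. split; [exact H|].
  rewrite <- RtoC_minus. intros E. apply RtoC_inj in E. lra.
Qed.

Lemma pole_function_bound (alpha : R) (f : C -> C) (z : C) :
  alpha < 1 -> convex_of_order alpha f -> unit_disk z ->
  Rbar_le (Finite (1 / (1 - alpha)))
    (extC_mod (extC_add (pole_function f z) (RtoC alpha * z / RtoC (1 - alpha))%C)).
Proof.
  intros Ha Hf Hz. assert (Hb := convex_second_derivative_bound alpha f Ha Hf z Hz).
  destruct (Ceq_dec (C_derive (C_derive f) z) (RtoC 0)) as [E|E].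
  - unfold pole_function. destruct (Ceq_dec _ _) as [_|N]; [exact I|contradiction].
  - rewrite shifted_pole by assumption.
    assert (Hp := proj1 (Cmod_gt_0 _) E).
    assert (Hc : RtoC (1 - alpha) <> RtoC 0).
    { intros E'. apply RtoC_inj in E'. lra. }
    simpl. rewrite Cmod_div, Cmod_mult, Cmod_R, Rabs_pos_eq by
      (try apply Cmult_neq_0; try assumption; lra).
    apply (proj1 (Rle_div_r _ _ _ (Rmult_lt_0_compat _ _ (proj2 (Rlt_0_minus _ _) Ha) Hp))).
    replace (1 / (1 - alpha) * ((1 - alpha) * Cmod (C_derive (C_derive f) z)))
      with (Cmod (C_derive (C_derive f) z)) by (field; lra).
    exact Hb.
Qed.

(** * The extremal function *)

(** The Taylor coefficients of [(1 - z) ^ (- kappa)]. *)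
Fixpoint binom_coef (kappa : R) (n : nat) : R :=
  match n with
  | O => 1
  | S m => binom_coef kappa m * (kappa + INR m) / INR (S m)
  end.

(** The coefficients increase with [kappa], and for [kappa = 2] they are exactly [n + 1]. *)
Lemma binom_coef_bound kappa n : 0 <= kappa <= 2 -> 0 <= binom_coef kappa n <= INR (S n).
Proof.
  intros Hk. induction n as [|n IH]; [simpl; lra|].
  assert (Hn := pos_INR n). change (binom_coef kappa (S n)) with
    (binom_coef kappa n * (kappa + INR n) / INR (S n)).
  rewrite S_INR in IH. rewrite !S_INR. split.
  - apply Rdiv_le_0_compat; [|lra]. apply Rmult_le_pos; lra.
  - apply Rle_div_l; [lra|].
    rewrite (Rmult_comm (INR n + 1 + 1)). apply Rmult_le_compat; lra.
Qed.

(** A primitive of [(1 - z) ^ (- kappa)], given by its Taylor series at [0]; no choice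
    of a complex logarithm is involved. *)
Lemma binom_series_exists kappa : 0 <= kappa <= 2 -> exists f : C -> C,
  expands f (RtoC 0) 1 (fun n => match n with O => RtoC 0
                        | S m => RtoC (binom_coef kappa m / INR (S m)) end).
Proof.
  intros Hk.
  set (a := fun n => match n with O => RtoC 0
                        | S m => RtoC (binom_coef kappa m / INR (S m)) end).
  assert (Ha : forall n, Cmod (a n) <= 1).
  { intros [|n]; unfold a.
    - rewrite Cmod_0; lra.
    - destruct (binom_coef_bound kappa n Hk) as [H1 H2].
      assert (H0 : 0 < INR (S n)) by (apply lt_0_INR; lia).
      rewrite Cmod_R, Rabs_pos_eq by (apply Rdiv_le_0_compat; lra).
      apply Rle_div_l; lra. }
  assert (H : forall w, exists l, Cmod w < 1 -> csum (fun n => a n * w ^ n)%C l).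
  { intros w. destruct (Rlt_dec (Cmod w) 1) as [Hw|Hw]; [|exists (RtoC 0); tauto].
    destruct (csum_geometric (fun n => a n * w ^ n)%C 1 (Cmod w)) as [l [Hl _]].
    - split; [apply Cmod_ge_0|exact Hw].
    - intros n. rewrite Cmod_mult, Cmod_pow. apply Rmult_le_compat_r; [|apply Ha].
      apply pow_le, Cmod_ge_0.
    - exists l. now intros _. }
  destruct (choice _ H) as [f Hf]. exists f. intros w Hw.
  replace (0 + w)%C with w by ring. now apply Hf.
Qed.

(** Comparison of coefficients:
    [(n + 1) * c (n + 1) - n * c n = kappa * c n] is the recursion of [binom_coef]. *)
Lemma binom_series_ode kappa F : expands F (RtoC 0) 1 (fun n => RtoC (binom_coef kappa n)) ->
  forall z, Cmod z < 1 -> ((1 - z) * C_derive F z = RtoC kappa * F z)%C.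
Proof.
  intros HF z Hz.
  assert (H1 := HF z Hz). assert (H2 := expands_derive _ _ _ _ HF z Hz).
  replace (0 + z)%C with z in H1, H2 by ring.
  assert (H3 : csum (fun n => RtoC (INR n * binom_coef kappa n) * z ^ n)%C
                    (z * C_derive F z)%C).
  { replace (z * C_derive F z)%C with
     (RtoC (INR 0 * binom_coef kappa 0) * z ^ 0 + z * C_derive F z)%C
     by (simpl; rewrite Rmult_0_l; ring).
    apply (csum_cons (fun n => RtoC (INR n * binom_coef kappa n) * z ^ n)%C).
    generalize (csum_scal z _ _ H2). apply csum_ext. intros n.
    rewrite RtoC_mult. simpl Cpow. ring. }
  apply (csum_unique (fun n => RtoC kappa * (RtoC (binom_coef kappa n) * z ^ n))%C).
  2:{ now apply csum_scal. }
  replace ((1 - z) * C_derive F z)%C with (C_derive F z - z * C_derive F z)%C by ring.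
  generalize (csum_minus _ _ _ _ H2 H3). apply csum_ext. intros n.
  assert (Hn : INR (S n) * binom_coef kappa (S n) = (kappa + INR n) * binom_coef kappa n).
  { change (binom_coef kappa (S n)) with
      (binom_coef kappa n * (kappa + INR n) / INR (S n)).
    field. apply not_0_INR. lia. }
  rewrite <- RtoC_mult, Hn, !RtoC_mult, RtoC_plus. ring.
Qed.

(** Applied to the real and imaginary parts, this turns a complex derivative along a
    ray into ordinary real calculus. *)
Lemma ray_derive (P : C -> R) (F : C -> C) (l z : C) (s K d : R) :
  (forall x y, P (x + y)%C = P x + P y) -> (forall r x, P (RtoC r * x)%C = r * P x) ->
  (forall x, Rabs (P x) <= Cmod x) -> 0 < d ->
  (forall w, Cmod w <= d -> Cmod (F (RtoC s * z + w) - F (RtoC s * z) - l * w)%C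
     <= K * Cmod w ^ 2) ->
  is_derive (fun t => P (F (RtoC t * z)%C)) s (P (l * z)%C).
Proof.
  intros HPa HPs HPb Hd HK. apply is_derive_Reals. intros eps He.
  set (A := Rabs K * Cmod z ^ 2 + 1).
  assert (HA : 0 < A).
  { unfold A. assert (0 <= Rabs K * Cmod z ^ 2); [|lra].
    apply Rmult_le_pos; [apply Rabs_pos|apply pow_le, Cmod_ge_0]. }
  assert (Hz := Cmod_ge_0 z).
  assert (Hdel : 0 < Rmin (d / (Cmod z + 1)) (eps / A)).
  { apply Rmin_glb_lt; apply Rdiv_lt_0_compat; lra. }
  exists (mkposreal _ Hdel). intros t Ht0 Ht. simpl in Ht.
  assert (Ht1 := Rlt_le_trans _ _ _ Ht (Rmin_l _ _)).
  assert (Ht2 := Rlt_le_trans _ _ _ Ht (Rmin_r _ _)).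
  assert (Htp := Rabs_pos_lt t Ht0).
  assert (Hw : Cmod (RtoC t * z)%C = Rabs t * Cmod z) by now rewrite Cmod_mult, Cmod_R.
  assert (Hwd : Cmod (RtoC t * z)%C <= d).
  { rewrite Hw. apply (Rmult_lt_compat_r (Cmod z + 1)) in Ht1; [|lra].
    replace (d / (Cmod z + 1) * (Cmod z + 1)) with d in Ht1 by (field; lra). nra. }
  specialize (HK _ Hwd). rewrite Hw in HK.
  set (R0 := (F (RtoC s * z + RtoC t * z) - F (RtoC s * z) - l * (RtoC t * z))%C) in HK.
  assert (Eq : P (F (RtoC (s + t) * z)%C) - P (F (RtoC s * z)%C) = t * P (l * z)%C + P R0).
  { replace (RtoC (s + t) * z)%C with (RtoC s * z + RtoC t * z)%C by (rewrite RtoC_plus; ring).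
    replace (F (RtoC s * z + RtoC t * z)%C) with
      (F (RtoC s * z) + (RtoC t * (l * z) + R0))%C by (unfold R0; ring).
    rewrite !HPa, HPs. ring. }
  rewrite Eq. replace ((t * P (l * z)%C + P R0) / t - P (l * z)%C) with (P R0 / t) by (field; exact Ht0).
  unfold Rdiv. rewrite Rabs_mult, Rabs_inv.
  apply (Rmult_lt_reg_r (Rabs t)); [exact Htp|].
  rewrite Rmult_assoc, Rinv_l, Rmult_1_r by lra.
  eapply Rle_lt_trans; [apply HPb|]. eapply Rle_lt_trans; [exact HK|].
  apply (Rmult_lt_compat_r A) in Ht2; [|lra].
  replace (eps / A * A) with eps in Ht2 by (field; lra).
  rewrite Rpow_mult_distr.
  assert (K * (Rabs t ^ 2 * Cmod z ^ 2) <= Rabs t * Rabs t * A).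
  { unfold A. replace (Rabs t * Rabs t * (Rabs K * Cmod z ^ 2 + 1)) with
      (Rabs K * (Rabs t ^ 2 * Cmod z ^ 2) + Rabs t ^ 2) by ring.
    assert (0 <= Rabs t ^ 2 * Cmod z ^ 2) by (apply Rmult_le_pos; apply pow_le; lra).
    assert (0 <= Rabs t ^ 2) by (apply pow_le; lra).
    generalize (Rle_abs K). nra. }
  nra.
Qed.

(** Along the ray from [0] to [z], the hypothesis [|G z| <= L |F|] on the derivative makes
    [|F| ^ 2 * exp (2 L s)] nondecreasing in [s], so [F] cannot reach [0] if it starts
    from a nonzero value. *)
Lemma gronwall_nonvanishing (F G : C -> C) (z : C) (L : R) :
  (forall s, 0 <= s <= 1 -> exists K d, 0 < d /\ forall w, Cmod w <= d ->
     Cmod (F (RtoC s * z + w) - F (RtoC s * z) - G (RtoC s * z) * w)%C <= K * Cmod w ^ 2) ->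
  (forall s, 0 <= s <= 1 -> Cmod (G (RtoC s * z) * z)%C <= L * Cmod (F (RtoC s * z)%C)) ->
  F (RtoC 0) <> RtoC 0 -> F z <> RtoC 0.
Proof.
  intros HF HG H0 Hz.
  set (p := fun s => Re (F (RtoC s * z)%C)). set (q := fun s => Im (F (RtoC s * z)%C)).
  set (p' := fun s => Re (G (RtoC s * z) * z)%C). set (q' := fun s => Im (G (RtoC s * z) * z)%C).
  assert (Hp : forall s, 0 <= s <= 1 -> is_derive p s (p' s)).
  { intros s Hs. destruct (HF s Hs) as (K & d & Hd & HK).
    apply (ray_derive Re F _ z s K d); try assumption.
    - reflexivity.
    - intros r x. unfold Re. simpl. ring.
    - apply re_le_Cmod. }
  assert (Hq : forall s, 0 <= s <= 1 -> is_derive q s (q' s)).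
  { intros s Hs. destruct (HF s Hs) as (K & d & Hd & HK).
    apply (ray_derive Im F _ z s K d); try assumption.
    - reflexivity.
    - intros r x. unfold Im. simpl. ring.
    - intros x. eapply Rle_trans; [|apply Rmax_Cmod]. apply Rmax_r. }
  set (N := fun s => (p s * p s + q s * q s) * exp (2 * L * s)).
  set (N' := fun s => 2 * (p s * p' s + q s * q' s + L * (p s * p s + q s * q s))
                      * exp (2 * L * s)).
  (* [N] is [|F| ^ 2 * exp (2 L s)] along the ray *)
  assert (HN : forall s, 0 <= s <= 1 -> is_derive N s (N' s)).
  { intros s Hs. apply is_derive_Reals.
    assert (Dp := proj1 (is_derive_Reals _ _ _) (Hp s Hs)).
    assert (Dq := proj1 (is_derive_Reals _ _ _) (Hq s Hs)).
    assert (De := derivable_pt_lim_comp _ exp _ _ _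
      (derivable_pt_lim_scal id (2 * L) s 1 (derivable_pt_lim_id s))
      (derivable_pt_lim_exp _)).
    assert (D := derivable_pt_lim_mult _ _ _ _ _
      (derivable_pt_lim_plus _ _ _ _ _ (derivable_pt_lim_mult _ _ _ _ _ Dp Dp)
         (derivable_pt_lim_mult _ _ _ _ _ Dq Dq)) De).
    replace (N' s) with
      ((p' s * p s + p s * p' s + (q' s * q s + q s * q' s)) * exp (2 * L * s)
       + (p s * p s + q s * q s) * (exp (2 * L * s) * (2 * L * 1)))
      by (unfold N'; ring).
    exact D. }
  assert (HN' : forall s, 0 <= s <= 1 -> 0 <= N' s).
  { intros s Hs. unfold N'. apply Rmult_le_pos; [|left; apply exp_pos].
    specialize (HG s Hs).
    assert (E : p s * p s + q s * q s = Cmod (F (RtoC s * z)%C) ^ 2).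
    { rewrite Cmod2_alt. unfold p, q. ring. }
    assert (H1 := re_le_Cmod (Cconj (F (RtoC s * z)%C) * (G (RtoC s * z) * z))%C).
    rewrite Cmod_mult, Cmod_conj in H1.
    replace (Re (Cconj (F (RtoC s * z)%C) * (G (RtoC s * z) * z))%C)
      with (p s * p' s + q s * q' s) in H1
      by (unfold p, q, p', q', Re, Im, Cconj; simpl; ring).
    rewrite E. apply Rabs_le_between in H1.
    generalize (Cmod_ge_0 (F (RtoC s * z)%C)). nra. }
  assert (Hmono : N 0 <= N 1).
  { destruct (MVT_gen N 0 1 N') as [s [Hs Heq]].
    - rewrite Rmin_left, Rmax_right by lra. intros x Hx. apply HN. lra.
    - rewrite Rmin_left, Rmax_right by lra. intros x Hx.
      apply continuity_pt_filterlim. apply (@ex_derive_continuous R_AbsRing R_NormedModule).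
      eexists. apply HN. lra.
    - rewrite Rmin_left, Rmax_right in Hs by lra. specialize (HN' s Hs). lra. }
  assert (HN0 : N 0 = Cmod (F (RtoC 0)) ^ 2).
  { unfold N, p, q. replace (RtoC 0 * z)%C with (RtoC 0) by ring.
    rewrite Rmult_0_r, exp_0, Cmod2_alt. ring. }
  assert (HN1 : N 1 = 0).
  { unfold N, p, q. replace (RtoC 1 * z)%C with z by ring. rewrite Hz.
    unfold Re, Im; simpl. ring. }
  assert (Hpos := pow_lt _ 2 (proj1 (Cmod_gt_0 _) H0)). lra.
Qed.

Lemma expands_first_order F rho a : expands F (RtoC 0) rho a -> forall z, Cmod z < rho ->
  exists K d, 0 < d /\ forall w, Cmod w <= d ->
    Cmod (F (z + w) - F z - C_derive F z * w)%C <= K * Cmod w ^ 2.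
Proof.
  intros HF z Hz. destruct (expands_recenter _ _ _ _ z HF Hz) as [b [Hb _]].
  replace (0 + z)%C with z in Hb by ring. set (r := rho - Cmod z) in Hb.
  assert (Hr : 0 < r) by (unfold r; lra).
  destruct (expands_remainder F z r b (r / 2) 2 Hb ltac:(lra)) as [K [_ HK]].
  exists K, (r / 2 / 2). split; [lra|]. intros w Hw. specialize (HK w Hw).
  rewrite (expands_derive_center _ _ _ _ Hb Hr), (expands_center _ _ _ _ Hb Hr).
  simpl taylor in HK.
  replace (F (z + w) - b 0%nat - b 1%nat * w)%C with
    (F (z + w) - (0 + b 0%nat * w ^ 0 + b 1%nat * w ^ 1))%C by (simpl; ring).
  exact HK.
Qed.

Lemma one_minus_neq_0 z : Cmod z < 1 -> (1 - z)%C <> RtoC 0.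
Proof.
  intros Hz E. replace z with (1 - (1 - z))%C in Hz by ring. rewrite E in Hz.
  replace (1 - 0)%C with (RtoC 1) in Hz by ring. rewrite Cmod_1 in Hz. lra.
Qed.

(** The differential equation bounds the logarithmic derivative on the segment from [0]
    to [z] by [kappa / (1 - |z|)]. *)
Lemma binom_series_neq_0 kappa F : 0 <= kappa ->
  expands F (RtoC 0) 1 (fun n => RtoC (binom_coef kappa n)) ->
  forall z, Cmod z < 1 -> F z <> RtoC 0.
Proof.
  intros Hk HF z Hz. assert (Hz0 := Cmod_ge_0 z).
  assert (Hin : forall s, 0 <= s <= 1 -> Cmod (RtoC s * z)%C <= Cmod z).
  { intros s Hs. rewrite Cmod_mult, Cmod_R, Rabs_pos_eq by lra. nra. }
  apply (gronwall_nonvanishing F (C_derive F) z (kappa * Cmod z / (1 - Cmod z))).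
  - intros s Hs. specialize (Hin s Hs). apply (expands_first_order _ _ _ HF). lra.
  - intros s Hs. specialize (Hin s Hs). set (x := (RtoC s * z)%C) in *.
    assert (Hode := binom_series_ode kappa F HF x ltac:(lra)).
    apply (f_equal Cmod) in Hode. rewrite !Cmod_mult, Cmod_R, Rabs_pos_eq in Hode by lra.
    assert (Hlow : 1 - Cmod z <= Cmod (1 - x)%C).
    { assert (H := Cmod_triangle (1 - x) x). replace (1 - x + x)%C with (RtoC 1) in H by ring.
      rewrite Cmod_1 in H. lra. }
    rewrite Cmod_mult.
    apply (Rmult_le_reg_l (1 - Cmod z)); [lra|].
    replace ((1 - Cmod z) * (kappa * Cmod z / (1 - Cmod z) * Cmod (F x)))
      with (Cmod z * (kappa * Cmod (F x))) by (field; lra).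
    rewrite <- Hode. generalize (Cmod_ge_0 (C_derive F x)). intros HD.
    replace ((1 - Cmod z) * (Cmod (C_derive F x) * Cmod z)) with
      (Cmod z * ((1 - Cmod z) * Cmod (C_derive F x))) by ring.
    apply Rmult_le_compat_l; [lra|]. apply Rmult_le_compat_r; lra.
  - rewrite (expands_center _ _ _ _ HF Rlt_0_1). simpl. intros E.
    apply RtoC_inj in E. lra.
Qed.

(** [1 + 2 z / (1 - z)] is the Cayley transform [(1 + z) / (1 - z)], which maps the disk
    to the right half-plane. *)
Lemma Re_cayley z : Cmod z < 1 -> -1 <= 2 * Re (z / (1 - z))%C.
Proof.
  intros Hz. assert (Hne := one_minus_neq_0 z Hz).
  assert (Hp := pow_lt _ 2 (proj1 (Cmod_gt_0 _) Hne)).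
  assert (Hz2 : Cmod z ^ 2 < 1) by (generalize (Cmod_ge_0 z); nra).
  rewrite Cmod2_alt in Hp, Hz2. destruct z as [x y]. unfold Re, Im in *. simpl in *.
  set (D := (1 + - x) * ((1 + - x) * 1) + (0 + - y) * ((0 + - y) * 1)) in *.
  match goal with |- _ <= 2 * ?e => replace e with ((x * (1 - x) - y * y) / D) end.
  - apply (Rmult_le_reg_r D); [exact Hp|].
    replace (2 * ((x * (1 - x) - y * y) / D) * D) with (2 * (x * (1 - x) - y * y))
      by (field; lra).
    unfold D. nra.
  - unfold D in *. field. lra.
Qed.

(** The extremal function has [f' = (1 - z) ^ (- 2 (1 - alpha))]. For it
    [1 + z f'' / f'] is [1 + 2 (1 - alpha) z / (1 - z)], which fills the half-plane
    [Re > alpha]. *)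
Lemma sharp_function (alpha : R) : 0 <= alpha < 1 ->
  exists f : C -> C, convex_of_order alpha f /\
    forall z, unit_disk z -> C_derive f z <> RtoC 0 /\
      ((1 - z) * C_derive (C_derive f) z = RtoC (2 * (1 - alpha)) * C_derive f z)%C.
Proof.
  intros Ha. set (kappa := 2 * (1 - alpha)).
  destruct (binom_series_exists kappa ltac:(unfold kappa; lra)) as [f Hf].
  assert (HF : expands (C_derive f) (RtoC 0) 1 (fun n => RtoC (binom_coef kappa n))).
  { refine (expands_ext _ _ _ _ _ _ (expands_derive _ _ _ _ Hf)).
    intros n. rewrite <- RtoC_mult. f_equal. field. apply not_0_INR. lia. }
  assert (Hne := binom_series_neq_0 kappa _ ltac:(unfold kappa; lra) HF).
  assert (Hode := binom_series_ode kappa _ HF).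
  exists f. split; [split; [|split]|].
  - intros z Hz. destruct (expands_recenter _ _ _ _ z Hf Hz) as [b [Hb _]].
    replace (0 + z)%C with z in Hb by ring. exists b, (1 - Cmod z).
    unfold unit_disk in Hz. split; [lra|]. now apply expands_pseries.
  - exact Hne.
  - intros z Hz. specialize (Hne z Hz). specialize (Hode z Hz).
    assert (H1 := one_minus_neq_0 z Hz).
    replace (1 + z * C_derive (C_derive f) z / C_derive f z)%C with
      (1 + RtoC kappa * (z / (1 - z)))%C.
    + assert (H := Re_cayley z Hz).
      replace (Re (1 + RtoC kappa * (z / (1 - z)))%C) with (1 + kappa * Re (z / (1 - z))%C)
        by (unfold Re; simpl; ring).
      unfold kappa. nra.
    + f_equal. replace (C_derive (C_derive f) z) with
        (RtoC kappa * C_derive f z / (1 - z))%C.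
      * field. now split.
      * rewrite <- Hode. field. exact H1.
  - intros z Hz. split; [now apply Hne|now apply Hode].
Qed.

Theorem theorem4p3 (alpha : R) (Halpha : 0 <= alpha < 1) :
  (forall f : C -> C, convex_of_order alpha f ->
     forall z : C, unit_disk z ->
       Rbar_le (Finite (1 / (1 - alpha)))
         (extC_mod (extC_add (pole_function f z)
                      (RtoC alpha * z / RtoC (1 - alpha))%C))) /\
  (exists f : C -> C, convex_of_order alpha f /\
     forall z : C, unit_disk z ->
       extC_mod (extC_add (pole_function f z)
                   (RtoC alpha * z / RtoC (1 - alpha))%C)
       = Finite (1 / (1 - alpha))).
Proof.
  split.
  - intros f Hf z Hz. apply pole_function_bound; [lra|assumption|assumption].
  - destruct (sharp_function alpha Halpha) as [f [Hf Hode]].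
    exists f. split; [exact Hf|]. intros z Hz. destruct (Hode z Hz) as [Hne He].
    assert (Hc : forall r, r <> 0 -> RtoC r <> RtoC 0).
    { intros r Hr E. apply RtoC_inj in E. contradiction. }
    assert (H2 : C_derive (C_derive f) z <> RtoC 0).
    { intros E. rewrite E, Cmult_0_r in He. symmetry in He. revert He.
      apply Cmult_neq_0; [apply Hc; lra|exact Hne]. }
    rewrite shifted_pole by (lra || exact H2). rewrite <- He.
    simpl. f_equal.
    replace ((z * C_derive (C_derive f) z + (1 - z) * C_derive (C_derive f) z)
         / (RtoC (1 - alpha) * C_derive (C_derive f) z))%C with (RtoC (1 / (1 - alpha))).
    + rewrite Cmod_R. apply Rabs_pos_eq. apply Rdiv_le_0_compat; lra.
    + rewrite RtoC_div by lra. field. split; [exact H2|apply Hc; lra].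
Qed.
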